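(* Consider the two-segment ($m=2$) min-max-energy platooning problem with arbitrary $n$, in which $\delta_j=\delta$ for all $j$ and $S_{j1}C_j\ge\bar L$ for all $j$, where $\bar L$ is sufficiently large that every solution is feasible. Rule 3 generates an optimal solution for this problem in $O(n)$ time, i.e. a solution minimizing $\max_{1\le j\le n}\delta\,[D_1(1-\eta_{j_1})+D_2(1-\eta_{j_2})]$.
   Context: Setting. There are $n$ vehicles and two road segments of lengths $D_1,D_2>0$. Vehicle $j$ has battery capacity $C_j>0$, usage rate $\delta_j>0$, initial state of charge $S_{j1}\in[0,1]$, and minimum allowable state of charge $\beta_j$ with $0\le\beta_j<S_{j1}$. Platoon positions have usage-rate reductions $0\le\eta_1\le\cdots\le\eta_n<1$. In a solution, $j_i$ denotes the position of vehicle $j$ in segment $i$ (for each $i$, $j\mapsto j_i$ is a permutation of $\{1,\ldots,n\}$). Vehicle $j$ uses energy $U_j=\delta_j\sum_{i=1}^2D_i(1-\eta_{j_i})$. A solution is feasible if $S_{j1}-U_j/C_j\ge\beta_j$ for all $j$; the problem is to minimize $\max_jU_j$ over feasible solutions. The condition $S_{j1}C_j\ge\bar L$ means that initial energy levels are large enough that any solution is feasible, e.g. $\bar L\ge\beta_jC_j+\sum_{i=1}^2D_i(1-\eta_1)\delta_j$ for each $j$. Rule 3: Assign vehicle $j$ to position $j$ in segment 1 and to position $n-j+1$ in segment 2, for $j=1,\ldots,n$. Running time counts elementary arithmetic operations and comparisons. *)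

(* Defs.v *)
From mathcomp Require Import all_boot all_order all_algebra all_fingroup.

Set Implicit Arguments.
Unset Strict Implicit.
Unset Printing Implicit Defensive.

Import Order.TTheory GRing.Theory Num.Theory.
Local Open Scope ring_scope.

(* Vehicles and positions 1, ..., n are both indexed by 'I_n = {0, ..., n-1},
   and the two segments by 'I_2. *)
Record platoon (R : realFieldType) (n : nat) := Platoon {
  len : 'I_2 -> R;            (* D_i *)
  reduction : 'I_n -> R;      (* eta, indexed by position *)
  capacity : 'I_n -> R;       (* C_j *)
  usage : 'I_n -> R;          (* delta_j *)
  min_soc : 'I_n -> R;        (* beta_j *)
  init_soc : 'I_n -> R        (* S_{j1} *)
}.

Section Problem.
Variables (R : realFieldType) (n : nat).
Implicit Types (P : platoon R n).

Definition valid_soc P (S : 'I_n -> R) : Prop :=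
  forall j, [/\ 0 <= S j, S j <= 1 & min_soc P j < S j].

Record valid P : Prop := Valid {
  len_gt0 : forall i, 0 < len P i;
  capacity_gt0 : forall j, 0 < capacity P j;
  usage_gt0 : forall j, 0 < usage P j;
  init_soc_valid : valid_soc P (init_soc P);
  min_soc_ge0 : forall j, 0 <= min_soc P j;
  reduction_ge0 : forall p, 0 <= reduction P p;
  reduction_mono : forall p q : 'I_n, (p <= q)%N -> reduction P p <= reduction P q;
  reduction_lt1 : forall p, reduction P p < 1
}.

(* [x i j] is the position j_i of vehicle j in segment i. *)
Definition solution := 'I_2 -> {perm 'I_n}.

Definition energy P (x : solution) (j : 'I_n) : R :=
  usage P j * \sum_(i < 2) len P i * (1 - reduction P (x i j)).

Definition feasible_from P (S : 'I_n -> R) (x : solution) : Prop :=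
  forall j, min_soc P j <= S j - energy P x j / capacity P j.

Definition feasible P (x : solution) : Prop :=
  feasible_from P (init_soc P) x.

(* The default 0 is harmless: on valid data all energies are nonnegative. *)
Definition max_energy P (x : solution) : R :=
  \big[Num.max/0]_(j < n) energy P x j.

Definition optimal P (x : solution) : Prop :=
  feasible P x /\ forall y, feasible P y -> max_energy P x <= max_energy P y.

(* Lbar is a property of the data other than the initial states of charge:
   initial energy levels of at least Lbar make every solution feasible. *)
Definition sufficient_energy P (Lbar : R) : Prop :=
  forall S : 'I_n -> R, valid_soc P S ->
    (forall j, Lbar <= S j * capacity P j) ->
  forall x, feasible_from P S x.

(* [rev_ord j] is position n - j + 1 when counting from 1. *)
Definition rule3 : solution :=
  fun i => if i == ord0 then 1%g else perm (@rev_ord_inj n).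

End Problem.

(* Running time: a while-language over natural-number registers with two
   write-only output arrays (one per segment).  Every arithmetic operation,
   comparison, assignment and array write costs 1. *)
Inductive expr := Const of nat | Reg of nat | Plus of expr & expr | Minus of expr & expr.

Inductive cmd :=
  | Assign of nat & expr                (* r := e *)
  | Write of 'I_2 & expr & expr         (* out_i[e1] := e2 *)
  | Seq of cmd & cmd
  | WhileLe of expr & expr & cmd.       (* while e1 <= e2 do c *)

Record state := State { reg : nat -> nat; out : 'I_2 -> nat -> nat }.

Fixpoint eval (s : state) (e : expr) : nat :=
  match e with
  | Const k => k
  | Reg r => reg s r
  | Plus e1 e2 => (eval s e1 + eval s e2)%N
  | Minus e1 e2 => (eval s e1 - eval s e2)%N
  end.

Fixpoint ecost (e : expr) : nat :=
  match e with
  | Const _ | Reg _ => 0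
  | Plus e1 e2 | Minus e1 e2 => (ecost e1 + ecost e2).+1
  end.

Definition set_reg (s : state) (r v : nat) : state :=
  State (fun r' => if r' == r then v else reg s r') (out s).

Definition set_out (s : state) (i : 'I_2) (a v : nat) : state :=
  State (reg s)
    (fun i' a' => if (i' == i) && (a' == a) then v else out s i' a').

(* [exec c s t s']: started in s, c terminates in s' after t unit-cost steps. *)
Inductive exec : cmd -> state -> nat -> state -> Prop :=
  | ExecAssign r e s :
      exec (Assign r e) s (ecost e).+1 (set_reg s r (eval s e))
  | ExecWrite i e1 e2 s :
      exec (Write i e1 e2) s (ecost e1 + ecost e2).+1
        (set_out s i (eval s e1) (eval s e2))
  | ExecSeq c1 c2 s t1 s1 t2 s2 :
      exec c1 s t1 s1 -> exec c2 s1 t2 s2 ->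
      exec (Seq c1 c2) s (t1 + t2)%N s2
  | ExecWhileStop e1 e2 c s :
      (eval s e2 < eval s e1)%N ->
      exec (WhileLe e1 e2 c) s (ecost e1 + ecost e2).+1 s
  | ExecWhileStep e1 e2 c s t1 s1 t2 s2 :
      (eval s e1 <= eval s e2)%N ->
      exec c s t1 s1 -> exec (WhileLe e1 e2 c) s1 t2 s2 ->
      exec (WhileLe e1 e2 c) s ((ecost e1 + ecost e2).+1 + t1 + t2)%N s2.

(* Rule 3 uses no data other than n, which is held in register 0. *)
Definition start (n : nat) : state :=
  State (fun r => if r == 0 then n else 0%N) (fun _ _ => 0%N).

(* j := 1; while j <= n do (out_1[j] := j; out_2[j] := n - j + 1; j := j + 1),
   with j in register 1. *)
Definition rule3_code : cmd :=
  let n := Reg 0 in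
  let j := Reg 1 in
  Seq (Assign 1 (Const 1))
    (WhileLe j n
      (Seq (Write ord0 j j)
      (Seq (Write ord_max j (Plus (Minus n j) (Const 1)))
           (Assign 1 (Plus j (Const 1)))))).

(* The output arrays hold x, vehicles and positions being counted from 1. *)
Definition outputs (n : nat) (s : state) (x : solution n) : Prop :=
  forall (i : 'I_2) (j : 'I_n), out s i j.+1 = (x i j).+1.

(* Main.v *)
Require Import Defs.
From mathcomp Require Import all_boot all_order all_algebra all_fingroup.
From mathcomp Require Import zify.
Import Order.TTheory GRing.Theory Num.Theory.
Local Open Scope ring_scope.

(** Fix a vehicle [j] of Rule 3, at positions [j] and [n - j + 1].  In any other
    solution [j] vehicles occupy the first [j] positions of segment 1 and
    [n - j + 1] vehicles the first [n - j + 1] positions of segment 2; as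
    [j + (n - j + 1) > n], some vehicle does both.  Reductions increase with the
    position, so this vehicle uses at least as much energy as [j] does in Rule 3. *)

Lemma perm_pair_le_rev (n : nat) (p q : {perm 'I_n}) (j : 'I_n) :
  exists k : 'I_n, (p k <= j)%N && (q k <= rev_ord j)%N.
Proof.
have card_le (r : {perm 'I_n}) (i : 'I_n) : #|[set k | (r k <= i)%N]| = i.+1.
  have <- : #|[set widen_ord (ltn_ord i) m | m : 'I_i.+1]| = i.+1.
    by rewrite card_imset ?card_ord // => m m' /(congr1 val) eq_m; apply: val_inj.
  (* As [r] is injective, the set is as large as its image, the positions [0] to [i]. *)
  rewrite -(card_imset _ (@perm_inj _ r)); apply: eq_card => m.
  apply/imsetP/imsetP => [[k]|[m' _ ->]].
    by rewrite inE -ltnS => rk ->; exists (Ordinal rk) => //; apply: val_inj.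
  by exists (r^-1%g (widen_ord (ltn_ord i) m')); rewrite ?inE permKV //= -ltnS.
(* Otherwise the two sets are disjoint, of total size [(j + 1) + (n - j) = n + 1] when counting from
   0. *)
apply/existsP; apply: contraT => /existsPn disj.
have := max_card ([set k | (p k <= j)%N] :|: [set k | (q k <= rev_ord j)%N]).
rewrite card_ord cardsU !card_le.
have -> : [set k | (p k <= j)%N] :&: [set k | (q k <= rev_ord j)%N] = set0.
  by apply/setP => k; rewrite !inE (negbTE (disj k)).
by rewrite cards0 /=; have := ltn_ord j; lia.
Qed.

Definition rule3_loop : cmd :=
  WhileLe (Reg 1) (Reg 0)
    (Seq (Write ord0 (Reg 1) (Reg 1))
    (Seq (Write ord_max (Reg 1) (Plus (Minus (Reg 0) (Reg 1)) (Const 1)))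
         (Assign 1 (Plus (Reg 1) (Const 1))))).

(** Induction on the number [k] of iterations left, from an arbitrary state since register 1 and the
    arrays change. The hypothesis is additive to avoid truncated subtraction; the extra 1 in the
    cost is the final failing test. *)
Lemma exec_rule3_loop (k : nat) (s : state) :
  (reg s 1 + k)%N = (reg s 0).+1 ->
  exists2 s', exec rule3_loop s (7 * k).+1 s' &
    forall i a, out s' i a =
      if (reg s 1 <= a <= reg s 0)%N
      then (if i == ord0 then a else (reg s 0 - a).+1) else out s i a.
Proof.
elim: k s => [|k IHk] s.
  rewrite addn0 => reg1; exists s; first by apply: ExecWhileStop; rewrite /= reg1.
  by move=> i a; rewrite reg1 ltnNge; case: leqP; rewrite ?andbF.
move=> regs.
pose s1 := set_out s ord0 (reg s 1) (reg s 1).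
pose s2 := set_out s1 ord_max (reg s 1) (reg s 0 - reg s 1 + 1).
pose s3 := set_reg s2 1 (reg s 1 + 1).
have [|s' loop_s3 out_s'] := IHk s3; first by rewrite /=; lia.
exists s'.
  (* One iteration costs 1 for the test, 1 and 3 for the writes, and 2 for the increment. *)
  have -> : (7 * k.+1).+1 = (1 + (1 + (3 + 2)) + (7 * k).+1)%N by lia.
  apply: (@ExecWhileStep _ _ _ _ _ s3) loop_s3; first by rewrite /=; lia.
  apply: ExecSeq (ExecWrite _ _ _ _) _.
  exact: ExecSeq (ExecWrite _ _ _ _) (ExecAssign _ _ _).
move=> i a; rewrite out_s' /=.
(* Only the entry at [reg s 1] is set by this iteration; later ones leave it alone. *)
have [->|a_neq] := eqVneq a (reg s 1).
  rewrite !andbT addn1 ltnn leqnn /=.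
  have -> : (reg s 1 <= reg s 0)%N by lia.
  by case: i => [[|[|//]]] lti; rewrite /= ?addn1.
rewrite !andbF addn1.
have -> // : (reg s 1 < a <= reg s 0)%N = (reg s 1 <= a <= reg s 0)%N.
by rewrite ltn_neqAle eq_sym a_neq.
Qed.

Lemma exec_rule3_code (n : nat) :
  exists2 s, exec rule3_code (start n) (7 * n + 2) s & outputs s (rule3 n).
Proof.
have [|s loop_s out_s] := @exec_rule3_loop n (set_reg (start n) 1 1).
  by rewrite /= add1n.
exists s.
  have -> : (7 * n + 2 = 1 + (7 * n).+1)%N by lia.
  exact: ExecSeq (ExecAssign 1 (Const 1) _) loop_s.
move=> i j; rewrite out_s /= ltn_ord /rule3.
(* In segment 2 the entry at [j.+1] is [(n - j.+1).+1], and [rev_ord j] is [n - j.+1]. *)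
case: (i == ord0); first by rewrite perm1.
by rewrite permE.
Qed.

Lemma rule3_max_energy_le (R : realFieldType) (n : nat) (P : platoon R n)
    (delta : R) (y : solution n) :
  valid P -> (forall j, usage P j = delta) ->
  max_energy P (rule3 n) <= max_energy P y.
Proof.
move=> validP usageP.
have energy_ge0 x j : 0 <= energy P x j.
  rewrite /energy mulr_ge0 ?(ltW (usage_gt0 validP j)) ?sumr_ge0 // => i _.
  by rewrite mulr_ge0 ?(ltW (len_gt0 validP i)) // subr_ge0 ltW // reduction_lt1.
apply: bigmax_le => [|j _].
  (* The default [0] of the left maximum must be bounded as well. *)
  by apply: (big_ind (fun u : R => 0 <= u)) => // u v u0 v0; rewrite le_max u0.
have [k /andP[le1 le2]] := perm_pair_le_rev _ (y ord0) (y ord_max) j.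
apply: le_trans (le_bigmax _ _ k).
rewrite /energy !usageP ler_wpM2l //; first by rewrite -(usageP j) ltW ?usage_gt0.
apply: ler_sum => i _; rewrite ler_wpM2l ?(ltW (len_gt0 validP i)) //.
rewrite lerD2l lerN2; apply: reduction_mono => //.
have [->|->] : i = ord0 \/ i = ord_max.
- by case: i => [[|[|//]]] lti; [left|right]; apply: val_inj.
- by rewrite /rule3 eqxx perm1.
- by rewrite /rule3 permE.
Qed.

Theorem proposition14 :
  exists c : nat,
  forall (R : realFieldType) (n : nat) (P : platoon R n) (delta Lbar : R),
    (0 < n)%N ->
    valid P ->
    (forall j : 'I_n, usage P j = delta) ->
    sufficient_energy P Lbar ->
    (forall j : 'I_n, Lbar <= init_soc P j * capacity P j) ->
    exists (t : nat) (s : state),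
      [/\ exec rule3_code (start n) t s,
          (t <= c * n)%N,
          outputs s (rule3 n)
        & optimal P (rule3 n)].
Proof.
(* [7 * n + 2 <= 9 * n] because [n] is positive. *)
exists 9 => R n P delta Lbar n_gt0 validP usageP suffP initP.
have [s exec_s out_s] := exec_rule3_code n.
exists (7 * n + 2)%N, s; split=> //; first by lia.
split=> [|y _]; last exact: rule3_max_energy_le usageP.
exact: suffP (init_soc_valid validP) initP _.
Qed.
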